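(* Let $d\ge1$, $\lambda>0$, $\delta>0$, and let $f:\mathbb{R}^d\to\mathbb{R}$ satisfy: (A1) $f$ is continuous and has at least one minimizer; (A2) $\int_{\mathbb{R}^d}\exp(-f(y)/\delta)\,dy<+\infty$. Let $(x^k)_{k\in\mathbb{N}}$ be generated by ZOPPA. Then (i) $f^{\lambda,\delta}(x^k)\le f^{\lambda,\delta}(x^{k-1})-\frac{1}{2\lambda}\|x^k-x^{k-1}\|^2$ for all $k\ge1$, and (ii) $\|\nabla f^{\lambda,\delta}(x^k)\|=\frac{\|x^{k+1}-x^k\|}{\lambda}\to0$ as $k\to\infty$.
   Context: The zeroth-order proximal operator is $\operatorname{zprox}^\delta_{\lambda,f}(x)=\dfrac{\mathbb{E}_{y\sim\mathcal N(x,\lambda\delta I)}[y\exp(-f(y)/\delta)]}{\mathbb{E}_{y\sim\mathcal N(x,\lambda\delta I)}[\exp(-f(y)/\delta)]}$; the soft Moreau envelope is $f^{\lambda,\delta}(x)=-\delta\log\mathbb{E}_{y\sim\mathcal N(x,\lambda\delta I)}[\exp(-f(y)/\delta)]$. ZOPPA: given $x^0\in\mathbb{R}^d$, iterate $x^{k+1}=\operatorname{zprox}^\delta_{\lambda,f}(x^k)$. *)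

(* Defs.v *)
From HB Require Import structures.
From mathcomp Require Import all_boot all_order all_algebra.
From mathcomp Require Import all_classical all_reals all_analysis.
From mathcomp Require Import normal_distribution.
Set Implicit Arguments.
Unset Strict Implicit.
Unset Printing Implicit Defensive.
Import Order.TTheory GRing.Theory Num.Theory.
Import numFieldNormedType.Exports.
Local Open Scope classical_set_scope.
Local Open Scope ring_scope.

Section ZOPPA.
Context {R : realType}.

(* Iterated Lebesgue integral over R^n (points given as n-tuples):
   integral over the first coordinate outermost, i.e. the Lebesgue
   integral on R^n written out by Fubini/Tonelli. *)
Fixpoint iint (n : nat) : (n.-tuple R -> \bar R) -> \bar R :=
  match n with
  | 0 => fun g => g [tuple]
  | n'.+1 => fun g =>
      (\int[@lebesgue_measure R]_(x in [set: R])
         iint (fun t : n'.-tuple R => g (cons_tuple x t)))%E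
  end.

Definition lebRd (d : nat) (g : 'rV[R]_d -> \bar R) : \bar R :=
  iint (fun t : d.-tuple R => g (\row_i tnth t i)).

Definition gauss_expect (d : nat) (x : 'rV[R]_d) (v : R)
    (h : 'rV[R]_d -> R) : R :=
  fine (lebRd (fun y => (h y * \prod_(i < d) normal_pdf (x 0 i) (Num.sqrt v) (y 0 i))%:E)).

Definition zprox (d : nat) (lam del : R) (f : 'rV[R]_d -> R) (x : 'rV[R]_d)
    : 'rV[R]_d :=
  \row_j (gauss_expect x (lam * del) (fun y => y 0 j * expR (- f y / del)) /
          gauss_expect x (lam * del) (fun y => expR (- f y / del))).

Definition soft_moreau (d : nat) (lam del : R) (f : 'rV[R]_d -> R)
    (x : 'rV[R]_d) : R :=
  - del * ln (gauss_expect x (lam * del) (fun y => expR (- f y / del))).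

Definition enorm (d : nat) (v : 'rV[R]_d) : R :=
  Num.sqrt (\sum_(i < d) v 0 i ^+ 2).

Definition grad (d : nat) (g : 'rV[R]_d -> R) (x : 'rV[R]_d) : 'rV[R]_d :=
  \row_i ('d g x (delta_mx 0 i : 'rV[R]_d)).

End ZOPPA.

(* Main.v *)
(* Write Z(x) = E[exp(-f(y)/del)] for y ~ N(x, v I) with v = lam del, so that
   the soft envelope is -del ln Z, and let x' = zprox x.  Since
     N(x')(y) = N(x)(y) exp(<x'-x, y-x>/v - |x'-x|^2/(2v))
   and x' is the mean of y under the law of density exp(-f/del) N(x) / Z(x),
   Jensen's inequality gives Z(x') >= Z(x) exp(|x'-x|^2/(2v)): this is the
   descent estimate.  As Z is bounded above, the decrements are summable and
   the steps vanish.  Differentiability of Z comes from a Taylor bound of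
   N(x+h)(y) with remainder O(|h|^2) N(x, 2v I)(y), uniform in y; its
   differential at x is h |-> Z(x) <h, x'-x>/v.

   The iterated integrals are handled on the class of measurable functions
   dominated by a product of integrable functions of one variable, on which
   they are finite at every level, linear, monotone and strictly positive. *)
Require Import Defs.
From HB Require Import structures.
From mathcomp Require Import all_boot all_order all_algebra.
From mathcomp Require Import all_classical all_reals all_analysis.
From mathcomp Require Import measurable_realfun normal_distribution ring lra.
Set Implicit Arguments.
Unset Strict Implicit.
Unset Printing Implicit Defensive.
Import Order.TTheory GRing.Theory Num.Theory.
Import numFieldNormedType.Exports.
Local Open Scope classical_set_scope.
Local Open Scope ring_scope.

(** * Iterated Lebesgue integrals of functions dominated by a product *)

Section iterated_integral.
Context {R : realType}.
Notation mu := (@lebesgue_measure R).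

(** The parameter ranges over an arbitrary measurable space so that the induction can absorb the
    outermost variable into it. The integral is split into positive and negative parts because
    Tonelli's measurability result concerns nonnegative functions. *)
Lemma measurable_iint n d (T : measurableType d)
    (G : T * n.-tuple R -> \bar R) :
  measurable_fun setT G ->
  measurable_fun setT (fun s => iint (fun t => G (s, t))).
Proof.
elim: n d T G => [|n IH] d T G mG /=.
  apply: (measurableT_comp mG); apply/measurable_fun_pair => //=.
have mH : measurable_fun setT (fun p : T * R =>
    iint (fun t : n.-tuple R => G (p.1, cons_tuple p.2 t))).
  have := IH _ (T * R)%type
    (fun q : (T * R) * n.-tuple R => G (q.1.1, cons_tuple q.1.2 q.2)).
  apply; apply: (measurableT_comp mG); apply/measurable_fun_pair => /=.
    exact: measurableT_comp.
  apply: measurable_cons => //; exact: measurableT_comp.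
under eq_fun do rewrite integralE.
apply: emeasurable_funB.
- apply: (@measurable_fun_fubini_tonelli_F _ _ _ _ _ mu
    (fun p : T * R => (fun x => iint (fun t : n.-tuple R =>
        G (p.1, cons_tuple x t)))^\+%E p.2)) => //.
  apply: eq_measurable_fun (measurable_funepos mH) => p _.
  by rewrite !funeposE.
- apply: (@measurable_fun_fubini_tonelli_F _ _ _ _ _ mu
    (fun p : T * R => (fun x => iint (fun t : n.-tuple R =>
        G (p.1, cons_tuple x t)))^\-%E p.2)) => //.
  apply: eq_measurable_fun (measurable_funeneg mH) => p _.
  by rewrite !funenegE.
Qed.

(** Indexing by [nat] rather than ['I_n] makes dropping the first coordinate a plain shift, without
    casts between ordinals. *)
Definition weights (w : nat -> R -> R) := forall i,
  (forall t, 0 <= w i t) /\ mu.-integrable setT (EFin \o w i).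

Definition wbound n (w : nat -> R -> R) (M : R) (G : n.-tuple R -> R) :=
  forall t, `|G t| <= M * \prod_(i < n) w i (tnth t i).

Definition shiftw (w : nat -> R -> R) := fun i => w i.+1.

Lemma weights_shift w : weights w -> weights (shiftw w).
Proof. by move=> ww i; exact: ww. Qed.

Lemma wbound_cons n w M (G : n.+1.-tuple R -> R) x : wbound w M G ->
  wbound (shiftw w) (M * w 0%N x) (fun t : n.-tuple R => G (cons_tuple x t)).
Proof.
move=> GM t; have := GM (cons_tuple x t); rewrite big_ord_recl /= mulrA.
by under eq_bigr do rewrite tnthS /=.
Qed.

Lemma measurable_cons_section n (G : n.+1.-tuple R -> R) x :
  measurable_fun setT G ->
  measurable_fun setT (fun t : n.-tuple R => G (cons_tuple x t)).
Proof. by move=> mG; apply: (measurableT_comp mG); exact: measurable_cons. Qed.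

Lemma measurable_iint_cons n (G : n.+1.-tuple R -> R) :
  measurable_fun setT G ->
  measurable_fun setT
    (fun x : R => iint (fun t : n.-tuple R => (G (cons_tuple x t))%:E)).
Proof.
move=> mG.
apply: (@measurable_iint n _ R
  (fun p : R * n.-tuple R => (G (cons_tuple p.1 p.2))%:E)).
apply/measurable_EFinP; apply: (measurableT_comp mG).
exact: measurable_cons.
Qed.

Lemma le_abs_iint n w M (G : n.-tuple R -> R) : weights w -> 0 <= M ->
  measurable_fun setT G -> wbound w M G ->
  (`|iint (EFin \o G)| <=
     (M * \prod_(i < n) fine (\int[mu]_(x in setT) (w i x)%:E))%:E)%E.
Proof.
elim: n w M G => [|n IH] w M G ww M0 mG GM /=.
  by have := GM [tuple]; rewrite !big_ord0 lee_fin.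
set P := \prod_(i < n) fine (\int[mu]_(x in setT) (w i.+1 x)%:E).
have P0 : 0 <= P.
  apply: prodr_ge0 => i _; apply: fine_ge0; apply: integral_ge0 => x _.
  by rewrite lee_fin; case: (ww i.+1).
(* With the bound written as the integral of a multiple of [w 0], the outer integrands can be
   compared pointwise. *)
have -> : (M * \prod_(i < n.+1) fine (\int[mu]_(x in setT) (w i x)%:E))%:E
   = (\int[mu]_(x in setT) ((M * P) * w 0%N x)%:E)%E.
  under eq_integral do rewrite EFinM.
  case: (ww 0%N) => w0 iw0.
  rewrite integralZl//= big_ord_recl /= -/P EFinM EFinM fineK; last first.
    exact: integrable_fin_num.
  by rewrite EFinM -!muleA; congr (_ * _)%E; rewrite muleC.
apply: le_trans (le_abse_integral _ _ _) _ => //.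
  exact: measurable_iint_cons.
apply: ge0_le_integral => //=.
- by apply: measurableT_comp => //; exact: measurable_iint_cons.
- apply/measurable_EFinP; apply: measurable_funM => //.
  by case: (ww 0%N) => _ /integrableP[/measurable_EFinP].
- move=> x _.
  rewrite (mulrAC M P).
  apply: (IH (shiftw w) (M * w 0%N x) (fun t => G (cons_tuple x t))).
  - exact: weights_shift.
  - by rewrite mulr_ge0//; case: (ww 0%N).
  - exact: measurable_cons_section.
  - exact: wbound_cons.
Qed.

(** A product bound passes to every section, whereas an integrable function may have non-integrable
    sections; linearity and monotonicity of [iint] use integrability at each level. *)
Definition dominated n (G : n.-tuple R -> R) := measurable_fun setT G /\
  exists w M, [/\ weights w, 0 <= M & wbound w M G].

Lemma dominated_cons n (G : n.+1.-tuple R -> R) x : dominated G ->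
  dominated (fun t : n.-tuple R => G (cons_tuple x t)).
Proof.
move=> [mG [w [M [ww M0 GM]]]]; split; first exact: measurable_cons_section.
exists (shiftw w), (M * w 0%N x); split.
- exact: weights_shift.
- by rewrite mulr_ge0//; case: (ww 0%N).
- exact: wbound_cons.
Qed.

Lemma iint_fin_num n (G : n.-tuple R -> R) : dominated G ->
  iint (EFin \o G) \is a fin_num.
Proof.
move=> [mG [w [M [ww M0 GM]]]]; rewrite fin_num_abs.
by apply: le_lt_trans (le_abs_iint ww M0 mG GM) _; rewrite ltry.
Qed.

Lemma integrable_iint_cons n (G : n.+1.-tuple R -> R) : dominated G ->
  mu.-integrable setT
    (fun x => iint (fun t : n.-tuple R => (G (cons_tuple x t))%:E)).
Proof.
move=> [mG [w [M [ww M0 GM]]]].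
set P := \prod_(i < n) fine (\int[mu]_(x in setT) (w i.+1 x)%:E).
case: (ww 0%N) => w0 iw0.
apply: (le_integrable measurableT _ _
    (integrableZl measurableT (M * P) iw0)).
- exact: measurable_iint_cons.
- move=> x _; apply: le_trans (le_abs_iint (weights_shift ww) _
    (measurable_cons_section x mG) (wbound_cons x GM)) _.
    by rewrite mulr_ge0.
  by rewrite -EFinM /= lee_fin mulrAC ler_norm.
Qed.

Lemma iint_linear n a (F G : n.-tuple R -> R) : dominated F -> dominated G ->
  iint (fun t => (a * F t + G t)%:E) =
  (a%:E * iint (EFin \o F) + iint (EFin \o G))%E.
Proof.
elim: n F G => [//|n IH] F G dF dG /=.
under eq_integral => x _ do
  rewrite (IH (fun t => F (cons_tuple x t)) (fun t => G (cons_tuple x t))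
    (dominated_cons x dF) (dominated_cons x dG)).
rewrite integralD//=; last 2 first.
- by apply: integrableZl => //; exact: integrable_iint_cons.
- exact: integrable_iint_cons.
by rewrite integralZl//; exact: integrable_iint_cons.
Qed.

Lemma iint_le n (F G : n.-tuple R -> R) : dominated F -> dominated G ->
  (forall t, F t <= G t) -> (iint (EFin \o F) <= iint (EFin \o G))%E.
Proof.
elim: n F G => [|n IH] F G dF dG FG /=; first by rewrite lee_fin.
apply: le_integral => //; [exact: integrable_iint_cons..|].
by move=> x _; apply: (IH (fun t => F (cons_tuple x t))
  (fun t => G (cons_tuple x t))) => //; exact: dominated_cons.
Qed.

(** If the outer integral vanished, the inner one, positive everywhere by induction, would be zero
    almost everywhere, and the exceptional null set would contain [[0, 1]]. *)
Lemma iint_gt0 n (G : n.-tuple R -> R) : dominated G -> (forall t, 0 < G t) ->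
  (0 < iint (EFin \o G))%E.
Proof.
elim: n G => [|n IH] G dG G0 /=; first by rewrite lte_fin.
have H0 x : (0 < iint (fun t : n.-tuple R => (G (cons_tuple x t))%:E))%E.
  by apply: (IH (fun t => G (cons_tuple x t))) => //; exact: dominated_cons.
rewrite lt_neqAle; apply/andP; split; last first.
  by apply: integral_ge0 => x _; exact: ltW.
apply/eqP => /esym I0.
have := ae_eq_integral_abs mu measurableT (measurable_iint_cons dG.1).
case=> + _; case.
  by rewrite -[RHS]I0; apply: eq_integral => x _; rewrite gee0_abs// ltW.
move=> N [mN N0 sN].
have : (mu `[0%R, 1%R]%classic <= mu N)%E.
  apply: le_measure; rewrite ?inE// => x _; apply: sN => /= /(_ I) H.
  by have := H0 x; rewrite H ltxx.
by rewrite N0 lebesgue_measure_itv /= lte_fin ltr01 oppr0 adde0 lee_fin ler10.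
Qed.

End iterated_integral.

(** * Measurability of continuous functions on row vectors *)

Section integral_on_rows.
Context {R : realType}.

Definition row_of d (t : d.-tuple R) : 'rV[R]_d := \row_i tnth t i.

(** The preimage is a countable union of measurable boxes: those with rational centre and radius
    [1 / (k + 1)] that it contains. *)
Lemma measurable_preimage_open d (U : set 'rV[R]_d) : open U ->
  measurable ((@row_of d) @^-1` U).
Proof.
move=> oU.
pose box (q : d.-tuple rat) (k : nat) : set (d.-tuple R) :=
  \big[setI/setT]_(i < d)
    ((fun t : d.-tuple R => tnth t i) @^-1`
       ball (ratr (tnth q i) : R) k.+1%:R^-1).
have boxE q k t : box q k t <->
    forall i, ball (ratr (tnth q i) : R) k.+1%:R^-1 (tnth t i).
  rewrite /box -(bigcap_seq (index_enum 'I_d)); split=> [H i|H i _];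
    last exact: H.
  by apply: H; rewrite /= mem_index_enum.
(* [unpickle] enumerates the pairs of a centre and an index; numbers that code no pair contribute
   the empty set. *)
pose F n : set (d.-tuple R) := if unpickle n is Some qk then
  [set t | box qk.1 qk.2 t /\ (box qk.1 qk.2 `<=` (@row_of d) @^-1` U)]
  else set0.
have -> : (@row_of d) @^-1` U = \bigcup_n F n.
  apply/seteqP; split=> t; last first.
    by move=> [n _]; rewrite /F; case: unpickle => // qk [tb]; apply.
  rewrite /preimage /= => Ut.
  have /nbhs_ballP[e /= e0 eU] := open_nbhs_nbhs (conj oU Ut).
  (* The centre is within one radius of [t], and every point of the box within one radius of the
     centre, so the box fits in the ball as soon as two radii do. *)
  have [k ke] : exists k, k.+1%:R^-1 *+ 2 < e.
    have e2 : 0 < e / 2 by rewrite divr_gt0.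
    have [k _ /(_ k (leqnn k))] := near_infty_natSinv_lt (PosNum e2).
    by rewrite /= ltr_pdivlMr// mulr_natr; exists k.
  have k0 : 0 < k.+1%:R^-1 :> R by rewrite invr_gt0.
  have qP i : exists q : rat, ball (ratr q : R) k.+1%:R^-1 (tnth t i).
    have /rat_in_itvoo[q] : tnth t i - k.+1%:R^-1 < tnth t i + k.+1%:R^-1.
      by rewrite ltrBlDr -addrA ltrDl addr_gt0.
    rewrite in_itv /= => /andP[q1 q2]; exists q; rewrite /ball /= ltr_distl.
    by rewrite q1 q2.
  have [q {}qP] := choice qP.
  exists (pickle ([tuple q i | i < d], k)) => //; rewrite /F pickleK /=; split.
    by apply/boxE => i; rewrite tnth_mktuple.
  move=> s /boxE qs; apply: eU; split => // i j.
  rewrite !mxE; apply: (le_ball (ltW ke)); rewrite mulr2n.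
  apply: ball_triangle (qs j); rewrite tnth_mktuple; exact/ball_sym.
apply: bigcupT_measurable => n; rewrite /F; case: unpickle => [qk|//].
have [H|H] := pselect (box qk.1 qk.2 `<=` (@row_of d) @^-1` U).
  rewrite (_ : [set t | _] = box qk.1 qk.2); last first.
    by apply/seteqP; split=> t // [].
  apply: bigsetI_measurable => i _; rewrite -[X in measurable X]setTI.
  apply: measurable_tnth => //.
  exact: measurable_ball.
by rewrite (_ : [set t | _] = set0)//; apply/seteqP; split=> t // [].
Qed.

Lemma measurable_row_of_continuous d (h : 'rV[R]_d -> R) : continuous h ->
  measurable_fun setT (h \o (@row_of d)).
Proof.
move=> /continuousP ch; apply: (measurability _ (RGenOpens.measurableE R)).
move=> _ [_ [a [b ->] <-]]; rewrite setTI comp_preimage.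
by apply: measurable_preimage_open; apply: ch; exact: interval_open.
Qed.

End integral_on_rows.

(** * The integral on row vectors and Gaussian domination *)

Section dominated_integral.
Context {R : realType}.

Lemma dominated_linear n a (F G : n.-tuple R -> R) :
  dominated F -> dominated G -> dominated (fun t => a * F t + G t).
Proof.
move=> [mF [w [M [ww M0 FM]]]] [mG [u [N [wu N0 GN]]]]; split.
  by apply: measurable_funD => //; apply: measurable_funM.
(* As all weights are nonnegative, the product of the sums dominates each of the two products. *)
exists (fun i t => w i t + u i t), (`|a| * M + N); split.
- move=> i; have [w0 iw] := ww i; have [u0 iu] := wu i; split.
    by move=> t; rewrite addr_ge0.
  exact: (integrableD measurableT iw iu).
- by rewrite addr_ge0// mulr_ge0.
- move=> t; apply: le_trans (ler_normD _ _) _; rewrite normrM mulrDl -mulrA.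
  apply: lerD; [apply: ler_wpM2l => //; apply: le_trans (FM t) _
               |apply: le_trans (GN t) _];
    apply: ler_wpM2l => //; apply: ler_prod => i _;
    have [w0 _] := ww i; have [u0 _] := wu i; rewrite ?w0 ?u0 /=.
    by rewrite lerDl.
  by rewrite lerDr.
Qed.

Variable d : nat.
Implicit Types F G h : 'rV[R]_d -> R.

Definition admissible h := dominated (h \o (@row_of R d)).

(** On admissible functions the integral is finite, so [fine] loses nothing there. *)
Definition row_integral h : R := fine (lebRd (EFin \o h)).

Lemma admissible_linear a F G : admissible F -> admissible G ->
  admissible (fun y => a * F y + G y).
Proof. exact: dominated_linear. Qed.

Lemma row_integral_linear a F G : admissible F -> admissible G ->
  row_integral (fun y => a * F y + G y) = a * row_integral F + row_integral G.
Proof.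
move=> aF aG; rewrite /row_integral /lebRd.
rewrite (@iint_linear R d a (F \o (@row_of R d)) (G \o (@row_of R d)) aF aG).
have fF := iint_fin_num aF; have fG := iint_fin_num aG.
by rewrite fineD ?fineM// fin_numM.
Qed.

Lemma row_integral_le F G : admissible F -> admissible G ->
  (forall y, F y <= G y) -> row_integral F <= row_integral G.
Proof.
move=> aF aG FG; apply: fine_le;
  [exact: iint_fin_num aF|exact: iint_fin_num aG|].
by apply: (iint_le aF aG) => t; exact: FG.
Qed.

Lemma row_integral_gt0 F : admissible F -> (forall y, 0 < F y) ->
  0 < row_integral F.
Proof.
move=> aF F0; apply: fine_gt0; rewrite (iint_gt0 aF)/=; last first.
  by move=> t; exact: F0.
by rewrite ltey_eq; rewrite (iint_fin_num aF).
Qed.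

Lemma admissible0 : admissible (fun=> 0).
Proof.
split; first exact: measurable_cst.
exists (fun=> cst 0), 0; split => //.
- by move=> i; split => //; exact: integrable0.
- by move=> t; rewrite normr0 mul0r.
Qed.

Lemma row_integral0 : row_integral (fun=> 0) = 0.
Proof.
have := @row_integral_linear (-1) _ _ admissible0 admissible0.
under [in LHS]eq_fun do rewrite mulr0 addr0.
by rewrite mulN1r addNr.
Qed.

Lemma admissible_sum I (r : seq I) (c : I -> R) (F : I -> 'rV[R]_d -> R) :
  (forall i, admissible (F i)) ->
  admissible (fun y => \sum_(i <- r) c i * F i y).
Proof.
move=> aF; elim: r => [|i r IH].
  by under eq_fun do rewrite big_nil; exact: admissible0.
by under eq_fun do rewrite big_cons; exact: admissible_linear.
Qed.

Lemma row_integral_sum I (r : seq I) (c : I -> R) (F : I -> 'rV[R]_d -> R) :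
  (forall i, admissible (F i)) ->
  row_integral (fun y => \sum_(i <- r) c i * F i y) =
  \sum_(i <- r) c i * row_integral (F i).
Proof.
move=> aF; elim: r => [|i r IH].
  by under eq_fun do rewrite big_nil; rewrite big_nil row_integral0.
under eq_fun do rewrite big_cons.
by rewrite row_integral_linear ?IH ?big_cons//; exact: admissible_sum.
Qed.

Definition gauss (v : R) (x y : 'rV[R]_d) : R :=
  \prod_(i < d) normal_pdf (x 0 i) (Num.sqrt v) (y 0 i).

Definition sqdist (x y : 'rV[R]_d) : R := \sum_i (y 0 i - x 0 i) ^+ 2.

Definition gauss_peak (v : R) : R := normal_peak (Num.sqrt v) ^+ d.

Lemma gauss_peak_gt0 v : 0 < v -> 0 < gauss_peak v.
Proof.
by move=> v0; rewrite exprn_gt0// normal_peak_gt0// gt_eqF// sqrtr_gt0.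
Qed.

Lemma gaussE v x y : 0 < v ->
  gauss v x y = gauss_peak v * expR (- sqdist x y / (2 * v)).
Proof.
move=> v0; have s0 : Num.sqrt v != 0 by rewrite gt_eqF// sqrtr_gt0.
rewrite /gauss; under eq_bigr => i _ do rewrite normal_pdfE//.
rewrite big_split/= prodr_const card_ord; congr (_ * _).
rewrite /normal_fun -expR_sum; congr expR.
rewrite mulNr mulr_suml -sumrN; apply: eq_bigr => i _.
by rewrite sqr_sqrtr ?ltW// mulNr -mulr_natl.
Qed.

Lemma gauss_gt0 v x y : 0 < v -> 0 < gauss v x y.
Proof. by move=> v0; rewrite gaussE// mulr_gt0 ?gauss_peak_gt0 ?expR_gt0. Qed.

Lemma continuous_coord (i : 'I_d) : continuous (fun y : 'rV[R]_d => y 0 i).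
Proof. by move=> y; exact: coord_continuous. Qed.

Lemma continuous_gauss v x : 0 < v -> continuous (gauss v x).
Proof.
move=> v0 y; apply: continuous_big => [|]; first exact: mul_continuous.
move=> i _ z; apply: (@continuous_comp _ _ _ (fun z : 'rV[R]_d => z 0 i)).
  exact: continuous_coord.
by apply: continuous_normal_pdf; rewrite gt_eqF// sqrtr_gt0.
Qed.

(** The Gaussian is a product of one-variable densities of mass one, so it serves as the weight and
    the integral inherits the constant [M] in every dimension. *)
Lemma admissible_gauss v x M h : 0 < v -> 0 <= M ->
  measurable_fun setT (h \o (@row_of R d)) ->
  (forall y, `|h y| <= M * gauss v x y) ->
  admissible h /\ `|row_integral h| <= M.
Proof.
move=> v0 M0 mh hM.
(* Weights are indexed by all of [nat]; the mean [0] is a default for indices from [d] on. *)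
pose w (i : nat) := normal_pdf (if insub i is Some j then x 0 (j : 'I_d) else 0)
  (Num.sqrt v).
have ww : weights w.
  by move=> i; split; [move=> t; exact: normal_pdf_ge0
                      |exact: integrable_normal_pdf].
have hw : wbound w M (h \o (@row_of R d)).
  move=> t; have -> : \prod_(i < d) w i (tnth t i) = gauss v x (row_of t).
    by apply: eq_bigr => i _; rewrite /w valK mxE.
  exact: hM.
have ah : admissible h by split => //; exists w, M.
split => //; rewrite -lee_fin -abse_EFin /row_integral fineK; last first.
  exact: iint_fin_num ah.
apply: le_trans (le_abs_iint ww M0 mh hw) _; rewrite lee_fin.
rewrite big1 ?mulr1// => i _.
by rewrite /w integral_normal_pdf.
Qed.

End dominated_integral.

(** * Pointwise estimates for shifted Gaussians *)

Section gaussian_estimates.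
Context {R : realType}.

(** The inequality [1 + t <= expR t] at [a] and [- a] gives [0 <= e^a - 1 - a <= a (e^a - 1)]. The
    right side is at most [a^2 e^a] if [a >= 0], and at most [a^2] if [a < 0]. *)
Lemma expR_taylor1 (a : R) : `|expR a - 1 - a| <= a ^+ 2 * expR `|a|.
Proof.
have e1 := expR_ge1Dx a; have e0 := expR_gt0 a.
rewrite ger0_norm; last by lra.
have e2 : expR a - 1 <= a * expR a.
  have := expR_ge1Dx (- a); rewrite expRN -(ler_pM2r e0) mulVf ?gt_eqF// => h.
  by rewrite mulrBl mul1r in h; lra.
have [a0|a0] := leP 0 a.
  have : 0 <= a * (a * expR a - (expR a - 1)) by rewrite mulr_ge0 ?subr_ge0.
  by rewrite (ger0_norm a0) expr2; lra.
have h : 0 <= - a * (expR a - 1 - a) by apply: mulr_ge0; lra.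
have h' := expR_ge1Dx (- a).
have : 0 <= a ^+ 2 * (expR (- a) - 1) by apply: mulr_ge0; [exact: sqr_ge0|lra].
by rewrite (ltr0_norm a0); lra.
Qed.

Lemma sqr_le_expR (a : R) : 0 <= a -> a ^+ 2 <= 4 * expR a.
Proof.
move=> a0; have -> : expR a = expR (a / 2) ^+ 2.
  by rewrite -expRM_natl mulrC divfK.
have h := expR_ge1Dx (a / 2).
have : (a / 2) ^+ 2 <= expR (a / 2) ^+ 2.
  by apply: lerXn2r; rewrite ?nnegrE; lra.
by rewrite exprMn exprVn; lra.
Qed.

Variable d : nat.
Implicit Types x y h : 'rV[R]_d.

Lemma coord_le_norm h (i : 'I_d) : `|h 0 i| <= `|h|.
Proof.
rewrite [leRHS]mx_normrE.
exact: (le_bigmax _ (fun ij : 'I_1 * 'I_d => `|h ij.1 ij.2|) (0, i)).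
Qed.

(** For [|h| <= 1] the exponent relating the Gaussians at [x + h] and [x] is at most [|h|] times
    this quantity, which is free of [h]. The [+ 1] absorbs the term quadratic in [h]. *)
Definition growth (v : R) x y : R := \sum_i (`|y 0 i - x 0 i| + 1) / v.

Lemma growth_ge0 v x y : 0 < v -> 0 <= growth v x y.
Proof.
by move=> v0; apply: sumr_ge0 => i _; rewrite divr_ge0 ?addr_ge0// ltW.
Qed.

Definition tilt (v : R) x h y : R := \sum_i h 0 i / v * (y 0 i - x 0 i).
Definition half_sqnorm (v : R) h : R := \sum_i h 0 i ^+ 2 / (2 * v).

Lemma gauss_shift v x h y : 0 < v ->
  gauss v (x + h) y = gauss v x y * expR (tilt v x h y - half_sqnorm v h).
Proof.
move=> v0; rewrite !gaussE// -mulrA -expRD; congr (_ * expR _).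
rewrite /sqdist /tilt /half_sqnorm !mulNr !mulr_suml -!sumrN -!big_split /=.
by apply: eq_bigr => i _; rewrite !mxE; field; rewrite gt_eqF.
Qed.

(* The [6] comes from [2 (t + 1) - t^2 / 2 <= 6 - t^2 / 4]. *)
Definition tail_cst (v : R) : R :=
  gauss_peak d v / gauss_peak d (2 * v) * expR (d%:R * (6 / v)).

Lemma tail_cst_ge0 v : 0 < v -> 0 <= tail_cst v.
Proof.
move=> v0; rewrite mulr_ge0 ?expR_ge0// divr_ge0//;
  apply/ltW/gauss_peak_gt0 => //.
by rewrite mulr_gt0.
Qed.

(** Doubling the variance halves the quadratic decay; the half given up beats the linear growth,
    coordinate by coordinate, up to a constant. *)
Lemma gauss_growth v x y : 0 < v ->
  expR (2 * growth v x y) * gauss v x y <= tail_cst v * gauss (2 * v) x y.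
Proof.
move=> v0; have v20 : 0 < 2 * v by rewrite mulr_gt0.
rewrite !gaussE// /tail_cst.
have p0 := @gauss_peak_gt0 R d _ v0; have p20 := @gauss_peak_gt0 R d _ v20.
rewrite mulrCA -expRD.
have -> : gauss_peak d v / gauss_peak d (2 * v) * expR (d%:R * (6 / v)) *
   (gauss_peak d (2 * v) * expR (- sqdist x y / (2 * (2 * v)))) =
   gauss_peak d v * expR (d%:R * (6 / v) + - sqdist x y / (2 * (2 * v))).
  by rewrite expRD; field; rewrite gt_eqF.
have dsum c : d%:R * c = \sum_(i < d) c.
  by rewrite sumr_const card_ord mulr_natl.
rewrite ler_pM2l// ler_expR /growth /sqdist dsum.
rewrite !mulNr !mulr_suml mulr_sumr -!sumrN -!big_split /=.
apply: ler_sum => i _; set u := y 0 i - x 0 i.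
rewrite -(ler_pM2r v0).
have -> : (2 * ((`|u| + 1) / v) + - (u ^+ 2 / (2 * v))) * v =
    2 * (`|u| + 1) - u ^+ 2 / 2.
  by field; rewrite gt_eqF.
have -> : (6 / v + - (u ^+ 2 / (2 * (2 * v)))) * v = 6 - u ^+ 2 / 4.
  by field; rewrite gt_eqF.
rewrite -(real_normK (num_real u)).
(* The two sides differ by exactly this square. *)
by have := sqr_ge0 (`|u| / 2 - 2); lra.
Qed.

Lemma tilt_le v x h y : 0 < v -> `|h| <= 1 ->
  `|tilt v x h y - half_sqnorm v h| <= `|h| * growth v x y.
Proof.
move=> v0 h1; rewrite /tilt /half_sqnorm /growth -sumrB mulr_sumr.
apply: le_trans (ler_norm_sum _ _ _) _; apply: ler_sum => i _.
apply: le_trans (ler_normB _ _) _.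
have -> : `|h 0 i ^+ 2 / (2 * v)| = `|h 0 i| ^+ 2 / (2 * v).
  by rewrite normrM normrX [X in _ * X]gtr0_norm// invr_gt0 mulr_gt0.
rewrite !normrM normfV (gtr0_norm v0).
have hi := coord_le_norm h i; set u := y 0 i - x 0 i.
have -> : `|h| * ((`|u| + 1) / v) = `|h| * (`|u| / v) + `|h| * v^-1 by ring.
apply: lerD.
  by rewrite mulrAC -mulrA ler_wpM2r// divr_ge0// ltW.
have h2 : `|h 0 i| ^+ 2 <= `|h|.
  by rewrite expr2 (le_trans _ hi)// ler_piMr// (le_trans hi).
apply: ler_pM => //; first by rewrite invr_ge0 mulr_ge0// ltW.
by rewrite lef_pV2 ?posrE ?mulr_gt0//; lra.
Qed.

Lemma half_sqnorm_le v h : 0 < v ->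
  `|half_sqnorm v h| <= `|h| ^+ 2 * (d%:R / v).
Proof.
move=> v0; rewrite ger0_norm; last first.
  by apply: sumr_ge0 => i _; rewrite divr_ge0 ?sqr_ge0// mulr_ge0// ltW.
have -> : `|h| ^+ 2 * (d%:R / v) = \sum_(i < d) (`|h| ^+ 2 / v).
  by rewrite sumr_const card_ord -[RHS]mulr_natl mulrCA.
apply: ler_sum => i _.
rewrite -(real_normK (num_real (h 0 i))); apply: ler_pM.
- by rewrite sqr_ge0.
- by rewrite invr_ge0 mulr_ge0// ltW.
- by rewrite lerXn2r ?nnegrE//; exact: coord_le_norm.
- by rewrite lef_pV2 ?posrE ?mulr_gt0//; lra.
Qed.

(** With [a] the exponent, the error is the Gaussian times [(e^a - 1 - a) - half_sqnorm v h]. The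
    first term gives the [4], through [A^2 <= 4 e^A], and the second gives [d / v]. Both carry
    [expR (2 * A)], which the wider Gaussian absorbs. *)
Lemma gauss_taylor v x h y : 0 < v -> `|h| <= 1 ->
  `|gauss v (x + h) y - gauss v x y - gauss v x y * tilt v x h y| <=
  `|h| ^+ 2 * ((4 + d%:R / v) * tail_cst v) * gauss (2 * v) x y.
Proof.
move=> v0 h1; rewrite gauss_shift//.
set a := tilt v x h y - half_sqnorm v h; set k := gauss v x y.
set A := growth v x y.
have A0 : 0 <= A by exact: growth_ge0.
have -> : k * expR a - k - k * tilt v x h y =
    k * ((expR a - 1 - a) - half_sqnorm v h) by rewrite /a; ring.
have k0 : 0 < k by exact: gauss_gt0.
rewrite normrM gtr0_norm//.
have dv0 : 0 <= d%:R / v by rewrite divr_ge0// ltW.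
have aA := tilt_le x y v0 h1; rewrite -/a -/A in aA.
have aA' : `|a| <= A by apply: le_trans aA _; rewrite ler_piMl.
have eA : 1 <= expR (2 * A) by rewrite -expR0 ler_expR mulr_ge0.
have b1 : `|expR a - 1 - a| <= `|h| ^+ 2 * (4 * expR (2 * A)).
  apply: le_trans (expR_taylor1 a) _.
  rewrite -(real_normK (num_real a)).
  have -> : expR (2 * A) = expR A * expR A by rewrite -expRD; congr expR; ring.
  rewrite !mulrA; apply: ler_pM; rewrite ?expR_ge0 ?sqr_ge0 ?ler_expR//.
  apply: (@le_trans _ _ ((`|h| * A) ^+ 2)).
    by rewrite lerXn2r ?nnegrE// mulr_ge0.
  by rewrite exprMn -mulrA ler_wpM2l ?sqr_ge0// sqr_le_expR.
have b2 : `|half_sqnorm v h| <= `|h| ^+ 2 * (d%:R / v * expR (2 * A)).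
  apply: le_trans (half_sqnorm_le h v0) _; rewrite ler_wpM2l ?sqr_ge0//.
  by rewrite ler_peMr.
apply: (@le_trans _ _ (k * (`|h| ^+ 2 * ((4 + d%:R / v) * expR (2 * A))))).
  rewrite ler_wpM2l ?(ltW k0)//; apply: le_trans (ler_normB _ _) _.
  by rewrite [in leRHS]mulrDl mulrDr; exact: lerD.
have -> : k * (`|h| ^+ 2 * ((4 + d%:R / v) * expR (2 * A))) =
  (`|h| ^+ 2 * (4 + d%:R / v)) * (expR (2 * A) * k) by ring.
have -> : `|h| ^+ 2 * ((4 + d%:R / v) * tail_cst v) * gauss (2 * v) x y =
  (`|h| ^+ 2 * (4 + d%:R / v)) * (tail_cst v * gauss (2 * v) x y) by ring.
apply: ler_wpM2l; first by rewrite mulr_ge0 ?sqr_ge0 ?addr_ge0.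
exact: gauss_growth.
Qed.

End gaussian_estimates.

(** * Gaussian averages of a bounded positive continuous weight *)

Section gaussian_average.
Context {R : realType}.
Variables (d : nat) (v C : R) (g : 'rV[R]_d -> R).
Hypothesis v0 : 0 < v.
Hypothesis cg : continuous g.
Hypothesis g0 : forall y, 0 < g y.
Hypothesis gC : forall y, g y <= C.
Implicit Types x y h : 'rV[R]_d.

Let C0 : 0 <= C.
Proof. exact: le_trans (ltW (g0 0)) (gC 0). Qed.

(** [mass] and [moment] are the denominator and the numerators of the proximal map; [moment] is left
    unnormalised to stay linear in the integrand. *)
Definition mass x : R := row_integral (fun y => g y * gauss v x y).
Definition moment x (i : 'I_d) : R :=
  row_integral (fun y => y 0 i * g y * gauss v x y).

Let cgk x : continuous (fun y => g y * gauss v x y).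
Proof.
by move=> y; apply: continuousM; [exact: cg|exact: continuous_gauss].
Qed.

Lemma admissible_mass x :
  admissible (fun y => g y * gauss v x y) /\ `|mass x| <= C.
Proof.
apply: (admissible_gauss (x := x) v0 C0) => [|y].
  exact: measurable_row_of_continuous.
rewrite gtr0_norm; last by rewrite mulr_gt0// gauss_gt0.
by rewrite ler_pM2r ?gauss_gt0.
Qed.

Lemma mass_gt0 x : 0 < mass x.
Proof.
apply: row_integral_gt0 (admissible_mass x).1 _ => y.
by rewrite mulr_gt0// gauss_gt0.
Qed.

Lemma mass_le x : mass x <= C.
Proof. exact: le_trans (ler_norm _) (admissible_mass x).2. Qed.

(** The factor [y 0 i] is unbounded, so the Gaussian of variance [v] cannot serve as weight;
    [expR (2 * A)] bounds that factor and is paid for by passing to variance [2 * v]. *)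
Lemma admissible_moment x i :
  admissible (fun y => y 0 i * g y * gauss v x y).
Proof.
have v20 : 0 < 2 * v by rewrite mulr_gt0.
have T0 := tail_cst_ge0 d v0.
have K0 : 0 <= (`|x 0 i| + v) * (C * tail_cst d v).
  by apply: mulr_ge0; [rewrite addr_ge0// ltW|exact: mulr_ge0].
apply: (admissible_gauss (x := x) v20 K0 _ _).1.
  apply: measurable_row_of_continuous => y.
  apply: (@continuousM _ _ (fun y => y 0 i * g y) (gauss v x)).
    apply: (@continuousM _ _ (fun y : 'rV[R]_d => y 0 i) g); last exact: cg.
    exact: continuous_coord.
  exact: continuous_gauss.
move=> y; have A0 := growth_ge0 x y v0; set A := growth v x y in A0.
have eA : 1 <= expR (2 * A) by rewrite -expR0 ler_expR mulr_ge0.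
have yA : `|y 0 i| <= (`|x 0 i| + v) * expR (2 * A).
  rewrite mulrDl -[y 0 i](subrK (x 0 i)) addrC.
  apply: le_trans (ler_normD _ _) _; apply: lerD; first by rewrite ler_peMr.
  apply: (@le_trans _ _ (v * A)); last first.
    rewrite ler_wpM2l ?(ltW v0)//; have := expR_ge1Dx (2 * A); lra.
  rewrite /A /growth -mulr_suml mulrC divfK ?gt_eqF//.
  rewrite (bigD1 i)//= -addrA lerDl; apply: addr_ge0 => //.
  apply: sumr_ge0 => j _.
  exact: addr_ge0.
rewrite !normrM (gtr0_norm (g0 y)) (gtr0_norm (gauss_gt0 _ _ v0)).
apply: (@le_trans _ _ ((`|x 0 i| + v) * expR (2 * A) * C * gauss v x y)).
  rewrite ler_pM2r ?gauss_gt0//; apply: ler_pM => //; exact: ltW.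
have -> : (`|x 0 i| + v) * expR (2 * A) * C * gauss v x y =
  ((`|x 0 i| + v) * C) * (expR (2 * A) * gauss v x y) by ring.
have -> : (`|x 0 i| + v) * (C * tail_cst d v) * gauss (2 * v) x y =
  ((`|x 0 i| + v) * C) * (tail_cst d v * gauss (2 * v) x y) by ring.
apply: ler_wpM2l; last exact: gauss_growth.
by apply: mulr_ge0 => //; rewrite addr_ge0// ltW.
Qed.

(** Its integral is [v] times the [i]-th partial derivative of [mass] at [x]. *)
Definition centered x (i : 'I_d) y : R := (y 0 i - x 0 i) * (g y * gauss v x y).

Lemma centeredE x i : centered x i =
  fun y => - x 0 i * (g y * gauss v x y) + y 0 i * g y * gauss v x y.
Proof. by apply/funext => y; rewrite /centered; ring. Qed.

Lemma admissible_centered x i : admissible (centered x i).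
Proof.
rewrite centeredE; apply: admissible_linear; last exact: admissible_moment.
exact: (admissible_mass x).1.
Qed.

Lemma row_integral_centered x i :
  row_integral (centered x i) = moment x i - x 0 i * mass x.
Proof.
rewrite centeredE row_integral_linear.
- by rewrite -/(mass x) -/(moment x i); ring.
- exact: (admissible_mass x).1.
- exact: admissible_moment.
Qed.

Lemma tilt_gauss x h y : g y * (gauss v x y * tilt v x h y) =
  \sum_i (h 0 i / v) * centered x i y.
Proof.
by rewrite /tilt !mulr_sumr; apply: eq_bigr => i _; rewrite /centered; ring.
Qed.

(* Jensen's inequality for [exp], via [e^a >= e^q (1 + a - q)] where [q] is the
   mean of the exponent [a] under the tilted measure centred at [x]. *)
Lemma mass_jensen x x' : (forall i, x' 0 i = moment x i / mass x) ->
  mass x * expR (half_sqnorm v (x' - x)) <= mass x'.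
Proof.
move=> x'E; set h := x' - x; set q := half_sqnorm v h.
have Z0 := mass_gt0 x.
have cE i : row_integral (centered x i) = h 0 i * mass x.
  rewrite row_integral_centered /h !mxE x'E; field; by rewrite gt_eqF.
have aS : admissible (fun y =>
    \sum_i (expR q * (h 0 i / v)) * centered x i y).
  by apply: admissible_sum; exact: admissible_centered.
(* The mean of [tilt] is [2 * q], so the two terms integrate to [mass x * expR q] times [1 - 2 * q]
   and [2 * q]. *)
have -> : mass x * expR q = row_integral (fun y =>
    expR q * (1 - 2 * q) * (g y * gauss v x y) +
    \sum_i (expR q * (h 0 i / v)) * centered x i y).
  rewrite (row_integral_linear _ (admissible_mass x).1 aS).
  rewrite row_integral_sum; last exact: admissible_centered.
  rewrite -/(mass x).
  under eq_bigr do rewrite cE.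
  have -> : \sum_i expR q * (h 0 i / v) * (h 0 i * mass x) =
      expR q * mass x * (2 * q).
    rewrite /q /half_sqnorm !mulr_sumr; apply: eq_bigr => i _; field.
    by rewrite gt_eqF.
  by ring.
apply: row_integral_le.
- by apply: admissible_linear => //; exact: (admissible_mass x).1.
- exact: (admissible_mass x').1.
move=> y; have -> : \sum_i expR q * (h 0 i / v) * centered x i y =
    expR q * (g y * (gauss v x y * tilt v x h y)).
  rewrite tilt_gauss mulr_sumr; apply: eq_bigr => i _; ring.
have -> : x' = x + h by rewrite /h addrC subrK.
rewrite gauss_shift// -/q; set t := tilt v x h y.
have -> : expR q * (1 - 2 * q) * (g y * gauss v x y) +
    expR q * (g y * (gauss v x y * t)) =
  g y * (gauss v x y * (expR q * (1 + (t - q - q)))) by ring.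
rewrite ler_pM2l// ler_pM2l ?gauss_gt0//.
have -> : expR (t - q) = expR q * expR (t - q - q).
  by rewrite -expRD; congr expR; ring.
by rewrite ler_pM2l ?expR_gt0// expR_ge1Dx.
Qed.

(** The pointwise Taylor bound is multiplied by [g <= C] and integrated; the Gaussian of variance
    [2 * v] has mass one, so the constant survives. *)
Lemma mass_taylor x h : `|h| <= 1 ->
  `|mass (x + h) - mass x -
    \sum_i (h 0 i / v) * (moment x i - x 0 i * mass x)| <=
  C * ((4 + d%:R / v) * tail_cst d v) * `|h| ^+ 2.
Proof.
move=> h1; set c := _ * tail_cst d v.
have v20 : 0 < 2 * v by rewrite mulr_gt0.
have c0 : 0 <= c.
  by rewrite mulr_ge0 ?tail_cst_ge0// addr_ge0// divr_ge0// ltW.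
pose S y := \sum_i (h 0 i / v) * centered x i y.
have aS : admissible S by apply: admissible_sum; exact: admissible_centered.
(* The coefficients [-1] and [1] give the shape [a * F + G] on which linearity is stated. *)
pose D y := (-1) * (1 * (g y * gauss v x y) + S y) + g y * gauss v (x + h) y.
have aD1 : admissible (fun y => 1 * (g y * gauss v x y) + S y).
  by apply: admissible_linear => //; exact: (admissible_mass x).1.
have aD : admissible D.
  by apply: admissible_linear => //; exact: (admissible_mass (x + h)).1.
have -> : mass (x + h) - mass x -
    \sum_i (h 0 i / v) * (moment x i - x 0 i * mass x) = row_integral D.
  rewrite row_integral_linear//; last exact: (admissible_mass (x + h)).1.
  rewrite row_integral_linear//; last exact: (admissible_mass x).1.
  rewrite row_integral_sum; last exact: admissible_centered.
  under [in RHS]eq_bigr do rewrite row_integral_centered.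
  by rewrite -/(mass x) -/(mass (x + h)); ring.
have M0 : 0 <= C * c * `|h| ^+ 2.
  by apply: mulr_ge0; [exact: mulr_ge0|rewrite exprn_ge0].
apply: (admissible_gauss (x := x) v20 M0 aD.1 _).2 => y.
have -> : D y = g y *
    (gauss v (x + h) y - gauss v x y - gauss v x y * tilt v x h y).
  by rewrite /D /S -tilt_gauss; ring.
rewrite normrM (gtr0_norm (g0 y)).
have -> : C * c * `|h| ^+ 2 * gauss (2 * v) x y =
  C * (`|h| ^+ 2 * c * gauss (2 * v) x y) by ring.
by apply: ler_pM => //; [exact: ltW|exact: gauss_taylor].
Qed.

End gaussian_average.

(** * Differentials from quadratic remainders, and gradients *)

Section gradient_from_remainder.
Context {R : realType}.

Lemma diff_of_quadratic_remainder (V W : normedModType R) (F : V -> W)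
    (L : {linear V -> W}) (x : V) (K : R) : 0 <= K -> continuous L ->
  (forall h, `|h| <= 1 -> `|F (x + h) - F x - L h| <= K * `|h| ^+ 2) ->
  differentiable F x /\ 'd F x = L :> (V -> W).
Proof.
move=> K0 cL FK.
have FE : F \o shift x = cst (F x) + L +o_ 0 id.
  apply/eqaddoP => _/posnumP[e]; near=> h.
  rewrite [X in `|X|](_ : _ = F (x + h) - F x - L h); last first.
    by rewrite [x + h]addrC -addrA -opprD.
  have h1 : `|h| <= 1 by near: h; exact: nbhs0_le.
  apply: le_trans (FK _ h1) _; rewrite expr2 mulrA ler_wpM2r//.
  (* The [+ 1] keeps the denominator positive when [K = 0]. *)
  have he : `|h| <= e%:num / (K + 1).
    by near: h; apply: nbhs0_le; rewrite divr_gt0// ltr_wpDl.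
  apply: le_trans (ler_wpM2l K0 he) _.
  rewrite mulrA ler_pdivrMr ?ltr_wpDl// mulrC ler_wpM2l//.
  by rewrite lerDl.
have dE := diff_unique cL FE.
by split => //; apply/diff_locallyP; rewrite dE.
Unshelve. all: by end_near. Qed.

Variable d : nat.
Implicit Types x y h : 'rV[R]_d.

Definition dotp (c : 'I_d -> R) h : R := \sum_i h 0 i * c i.

Fact dotp_linear c : linear (dotp c : 'rV[R]_d -> R^o).
Proof.
move=> a h k; rewrite /dotp scaler_sumr -big_split /=; apply: eq_bigr => i _.
by rewrite !mxE mulrDl -mulrA.
Qed.

HB.instance Definition _ c :=
  GRing.isLinear.Build R 'rV[R]_d R^o *:%R (dotp c) (dotp_linear c).

Lemma continuous_dotp c : continuous (dotp c).
Proof.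
apply: continuous_big => [|i _]; first exact: add_continuous.
move=> y; apply: (@continuousM _ _ (fun y : 'rV[R]_d => y 0 i) (cst (c i))).
  exact: continuous_coord.
exact: cst_continuous.
Qed.

Lemma dotp_delta c i : dotp c (delta_mx 0 i) = c i.
Proof.
rewrite /dotp (bigD1 i)//= mxE !eqxx mul1r big1 ?addr0// => j ji.
by rewrite mxE eqxx (negbTE ji) mul0r.
Qed.

Lemma grad_ln a (F : 'rV[R]_d -> R) x c : 0 < F x ->
  differentiable F x -> 'd F x = dotp c :> ('rV[R]_d -> R) ->
  differentiable (fun y => a * ln (F y)) x /\
  grad (fun y => a * ln (F y)) x = \row_i (a / F x * c i).
Proof.
move=> Fx0 dF dFE.
have dl : is_derive (F x) 1 (a *: @ln R) (a *: (F x)^-1).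
  by apply: is_deriveZ; exact: is_derive1_ln.
have dl' : differentiable (a *: @ln R) (F x).
  by apply/derivable1_diffP; exact: ex_derive.
have -> : (fun y => a * ln (F y)) = (a *: @ln R) \o F by [].
split; first exact: differentiable_comp.
apply/rowP => i; rewrite !mxE diff_comp//= dFE diff1E//= dotp_delta.
by rewrite derive1E derive_val /GRing.scale /= mulrC.
Qed.

End gradient_from_remainder.

(** * Vanishing decrements along a descent sequence *)

(** [S] is nonincreasing and bounded below, hence convergent; its successive differences tend to
    zero and squeeze [c * u k]. *)
Lemma cvg_steps_of_descent {R : realType} (S u : nat -> R) (c m : R) :
  (forall k, m <= S k) -> (forall k, 0 <= u k) ->
  (forall k, S k.+1 <= S k - c * u k) -> 0 < c -> u @ \oo --> (0 : R).
Proof.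
move=> mS u0 Su c0.
have dS : nonincreasing_seq S.
  apply/nonincreasing_seqP => k; apply: le_trans (Su k) _.
  by rewrite gerBl mulr_ge0// ltW.
have cS : cvgn S.
  by apply: nonincreasing_is_cvgn => //; exists m => _ [k _ <-].
have S0 : (fun k => c^-1 * (S k - S k.+1)) @ \oo --> (0 : R).
  rewrite -(mulr0 c^-1) -(subrr (limn S)); apply: cvgMr; apply: cvgB => //.
  by rewrite (cvg_shiftS S).
apply: (squeeze_cvgr _ (cvg_cst 0) S0); near=> k.
rewrite u0 /= mulrC ler_pdivlMr// mulrC.
by have := Su k; lra.
Unshelve. all: by end_near. Qed.

(** * Application to the ZOPPA iteration *)

Unset Implicit Arguments.

Theorem theorem9 (R : realType) (d : nat) (lam del : R)
  (f : 'rV[R]_d -> R) (x : nat -> 'rV[R]_d) :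
  (0 < d)%N -> 0 < lam -> 0 < del ->
  continuous f ->
  (exists xs : 'rV[R]_d, forall y, f xs <= f y) ->
  (lebRd (fun y => (expR (- f y / del))%:E) < +oo)%E ->
  (forall k, x k.+1 = zprox lam del f (x k)) ->
  (forall k, soft_moreau lam del f (x k.+1) <=
     soft_moreau lam del f (x k) - (2 * lam)^-1 * enorm (x k.+1 - x k) ^+ 2)
  /\ (forall k, differentiable (soft_moreau lam del f) (x k) /\
        enorm (grad (soft_moreau lam del f) (x k)) = enorm (x k.+1 - x k) / lam)
  /\ ((fun k => enorm (x k.+1 - x k) / lam) @ \oo --> (0 : R)).
Proof.
move=> _ l0 e0 cf [xs fxs] _ xE.
have v0 : 0 < lam * del by rewrite mulr_gt0.
pose g y := expR (- f y / del).
have cg : continuous g.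
  move=> y; apply: continuous_comp; last exact: continuous_expR.
  by apply: (@continuousM _ _ (fun y => - f y) (cst del^-1));
    [exact/continuousN/cf|exact: cst_continuous].
have g0 y : 0 < g y by exact: expR_gt0.
(* The minimizer bounds the weight above, hence [mass] by [C] and the envelope below by
   [- del * ln C]. *)
have gC y : g y <= expR (- f xs / del).
  by rewrite ler_expR ler_pM2r ?invr_gt0// lerN2.
set C := expR _ in gC.
pose v := lam * del.
(* Holds by conversion: [gauss_expect] unfolds to [row_integral] of a product with [gauss]. *)
have sE y : soft_moreau lam del f y = - del * ln (mass v g y) by [].
have m0 y : 0 < mass v g y := mass_gt0 v0 cg g0 gC y.
have xkE k i : x k.+1 0 i = moment v g (x k) i / mass v g (x k).
  by rewrite xE mxE.
have nE (z : 'rV[R]_d) : enorm z ^+ 2 = \sum_i z 0 i ^+ 2.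
  by rewrite sqr_sqrtr// sumr_ge0// => i _; rewrite sqr_ge0.
have descent k : soft_moreau lam del f (x k.+1) <=
    soft_moreau lam del f (x k) - (2 * lam)^-1 * enorm (x k.+1 - x k) ^+ 2.
  have J := mass_jensen v0 cg g0 gC (xkE k).
  rewrite !sE nE.
  have : ln (mass v g (x k) * expR (half_sqnorm v (x k.+1 - x k))) <=
      ln (mass v g (x k.+1)) by rewrite ler_ln// posrE ?mulr_gt0 ?expR_gt0.
  rewrite lnM ?posrE ?expR_gt0// expRK => lnJ.
  (* The factor [del] in front of the logarithm cancels the one in the variance [lam * del]. *)
  have -> : (2 * lam)^-1 * (\sum_i (x k.+1 - x k) 0 i ^+ 2) =
      del * half_sqnorm v (x k.+1 - x k).
    rewrite /half_sqnorm !mulr_sumr; apply: eq_bigr => i _.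
    by rewrite /v; field; rewrite !gt_eqF.
  by have := ler_wpM2l (ltW e0) lnJ; lra.
split=> //; split.
  move=> k.
  (* The partial derivatives of [mass] at [x k], equal to [mass] times the step divided by [v]. *)
  pose c i := v^-1 * (moment v g (x k) i - x k 0 i * mass v g (x k)).
  have K0 : 0 <= C * ((4 + d%:R / v) * tail_cst d v).
    apply: mulr_ge0; first exact: expR_ge0.
    apply: mulr_ge0; last exact: tail_cst_ge0.
    by rewrite addr_ge0// divr_ge0// ltW.
  have [] := diff_of_quadratic_remainder
    (F := mass v g : 'rV[R]_d -> R^o) (L := dotp c) (x := x k)
    K0 (@continuous_dotp R d c).
    move=> h h1; have := mass_taylor v0 cg g0 gC (x k) h1.
    rewrite /dotp; under eq_bigr do rewrite -mulrA. exact.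
  move=> dm dmE.
  have [ds gs] := grad_ln (- del) (m0 (x k)) dm dmE.
  split; first exact: ds.
  (* ZOPPA is gradient descent on the soft envelope with step size [lam]. *)
  have -> : grad (soft_moreau lam del f) (x k) = - lam^-1 *: (x k.+1 - x k).
    rewrite [LHS]gs; apply/rowP => i; rewrite !mxE xkE /c /v; field.
    by rewrite !gt_eqF.
  rewrite /enorm.
  under eq_bigr do rewrite mxE exprMn sqrrN.
  rewrite -mulr_sumr sqrtrM ?sqr_ge0// sqrtr_sqr ger0_norm ?invr_ge0 ?ltW//.
  by rewrite mulrC.
have u0 : (fun k => enorm (x k.+1 - x k) ^+ 2) @ \oo --> (0 : R).
  apply: (@cvg_steps_of_descent R (fun k => soft_moreau lam del f (x k)) _
    (2 * lam)^-1 (- del * ln C)) => //.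
  - move=> k; rewrite sE !mulNr lerN2 ler_pM2l// ler_ln ?posrE ?expR_gt0//.
    exact: mass_le.
  - by move=> k; rewrite sqr_ge0.
  - by rewrite invr_gt0 mulr_gt0.
(* Continuity of the square root at [0] passes from squared steps to steps. *)
rewrite -(mul0r lam^-1); apply: cvgMl; rewrite -sqrtr0.
rewrite (_ : (fun k => enorm _) =
    Num.sqrt \o (fun k => enorm (x k.+1 - x k) ^+ 2)); last first.
  by apply/funext => k /=; rewrite sqrtr_sqr ger0_norm// sqrtr_ge0.
by apply: (cvg_comp _ _ u0); exact: sqrt_continuous.
Qed.
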